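(* Let $\sigma>0$, $\eta\ge 0$, $\epsilon>0$, let $n\ge 1$ be an integer, let $X\sim\mathcal{N}(0,\sigma^2)$, and set $$B_2=\frac{\eta^2 + 2 \eta\sqrt{n\sigma^2(1+2\epsilon)}}{2n\sigma^2}+\epsilon .$$ Then the volume of the typical set $A_{B_2}^{(n)}(X)$ (the typical set for Gaussian noise perturbed by a vector of $L_2$ norm at most $\eta$) satisfies $$\mathrm{Vol}\big(A_{B_2}^{(n)}(X)\big) \leq \Big(2^{\left(\frac{\eta^2+2\eta\sqrt{n\sigma^2(1+2\epsilon)}}{2n\sigma^2}+\epsilon\right)}\sqrt{2\pi e}\, \sigma\Big)^n .$$
   Context: $\log$ denotes the base-2 logarithm and $f$ is the density of $X$. The differential entropy of $X$ is $h(X)=-\int_{\mathbb{R}} f(x)\log f(x)\,dx$, which equals $\log(\sqrt{2\pi e}\,\sigma)$. For $B>0$ the typical set is $$A_B^{(n)}(X)=\Big\{(x_1,\dots,x_n)\in\mathbb{R}^n:\Big|-\frac1n\log f(x_1,\dots,x_n)-h(X)\Big|\le B\Big\},$$ where $f(x_1,\dots,x_n)=\prod_{i=1}^n f(x_i)$. $\mathrm{Vol}(A)=\int_A dx_1\cdots dx_n$ is Lebesgue measure. *)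

(* Defs.v *)
From HB Require Import structures.
From mathcomp Require Import all_boot all_order all_algebra.
From mathcomp Require Import all_classical all_reals all_analysis.

Set Implicit Arguments.
Unset Strict Implicit.
Unset Printing Implicit Defensive.

Import Order.TTheory GRing.Theory Num.Theory.
Import numFieldNormedType.Exports.

Local Open Scope classical_set_scope.
Local Open Scope ring_scope.

Section lebesgue_measure_cons.
Context {R : realType} (n : nat).
Variable m : {sigma_finite_measure set (n.-tuple (measurableTypeR R)) -> \bar R}.

Definition tuple_consp (p : measurableTypeR R * n.-tuple (measurableTypeR R)) :
  n.+1.-tuple (measurableTypeR R) := [tuple of p.1 :: p.2].

Lemma measurable_tuple_consp : measurable_fun setT tuple_consp.
Proof. exact: measurable_cons. Qed.

HB.instance Definition _ := isMeasurableFun.Build _ _ _ _ tuple_consp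
  measurable_tuple_consp.

Definition lebesgue_measure_cons :=
  pushforward (lebesgue_measure \x m)%E tuple_consp.

Let cons0 : lebesgue_measure_cons set0 = 0%E.
Proof. exact: measure0. Qed.

Let cons_ge0 A : (0 <= lebesgue_measure_cons A)%E.
Proof. exact: measure_ge0. Qed.

Let cons_sigma_additive : semi_sigma_additive lebesgue_measure_cons.
Proof. exact: measure_semi_sigma_additive. Qed.

HB.instance Definition _ := isMeasure.Build _ _ _ lebesgue_measure_cons
  cons0 cons_ge0 cons_sigma_additive.

Let sigma_finite_cons : sigma_finite setT lebesgue_measure_cons.
Proof.
have /sigma_finiteP[F [TF ndF Foo]] :=
  sigma_finiteT (@lebesgue_measure R).
have /sigma_finiteP[G [TG ndG Goo]] := sigma_finiteT m.
pose uncons (x : n.+1.-tuple (measurableTypeR R)) :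
  measurableTypeR R * n.-tuple (measurableTypeR R) :=
  (thead x, [tuple of behead x]).
have tuple_conspK : cancel tuple_consp uncons.
  by case=> a b; rewrite /uncons/= theadE; congr pair; exact: val_inj.
have muncons : measurable_fun setT uncons.
  by apply/measurable_fun_pair; [exact: measurable_tnth|exact: measurable_behead].
exists (fun k => uncons @^-1` (F k `*` G k)).
  apply/seteqP; split=> // x _.
  have : setT (thead x) by []; rewrite {1}TF => -[k _ Fk].
  have : setT [tuple of behead x] by []; rewrite {1}TG => -[l _ Gl].
  exists (maxn k l) => //; split=> /=.
    by move: Fk; exact/subsetPset/ndF/leq_maxl.
  by move: Gl; exact/subsetPset/ndG/leq_maxr.
move=> k; have [mFk Fkoo] := Foo k; have [mGk Gkoo] := Goo k; split.
  by rewrite -[X in measurable X]setTI; apply: muncons => //; exact: measurableX.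
rewrite /lebesgue_measure_cons /pushforward -comp_preimage.
rewrite (_ : uncons \o _ = id); last exact/funext.
by rewrite product_measure1E// lte_mul_pinfty// ge0_fin_numE.
Qed.

HB.instance Definition _ := Measure_isSigmaFinite.Build _ _ _
  lebesgue_measure_cons sigma_finite_cons.

End lebesgue_measure_cons.

(* Lebesgue measure on [R^n], as the [n]-fold product of [lebesgue_measure];
   see [lebesgue_measure_tuple_box]. *)
Fixpoint lebesgue_measure_tuple {R : realType} (n : nat) :
    {sigma_finite_measure set (n.-tuple (measurableTypeR R)) -> \bar R} :=
  if n is m.+1 then lebesgue_measure_cons (lebesgue_measure_tuple m)
  else \d_([tuple] : 0.-tuple (measurableTypeR R)).

Lemma lebesgue_measure_tuple_box {R : realType} (n : nat)
    (A : 'I_n -> set (measurableTypeR R)) :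
  (forall i, measurable (A i)) ->
  lebesgue_measure_tuple n [set x | forall i, A i (tnth x i)] =
  (\prod_(i < n) lebesgue_measure (A i))%E.
Proof.
elim: n A => [|n IH] A mA /=.
  by rewrite big_ord0 diracE mem_set// => -[].
rewrite big_ord_recl -(IH (fun i => A (lift ord0 i)))//.
rewrite /lebesgue_measure_cons /pushforward.
rewrite -product_measure1E//; last first.
  rewrite (_ : mkset _ = \bigcap_i ((@tnth n _ ^~ i) @^-1` A (lift ord0 i))).
    apply: fin_bigcap_measurable => //= i _.
    by rewrite -[X in measurable X]setTI; exact: measurable_tnth.
  by apply/seteqP; split=> x /= Ax i; [move=> _|]; exact: Ax.
congr (_ \x _)%E; apply/seteqP; split=> -[a b] /= Aab.
  split; first by have := Aab ord0.
  by move=> i; have := Aab (lift ord0 i); rewrite tnthS.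
by move=> i; case: (unliftP ord0 i) => [j|] ->; [rewrite tnthS; exact: Aab.2|exact: Aab.1].
Qed.

Section information_theory.
Context {R : realType}.
Implicit Types (f : R -> R) (x B : R).

Definition log2 x : R := ln x / ln 2.

Definition is_density {d} {T : measurableType d} {P : probability T R}
    (X : {RV P >-> measurableTypeR R}) f : Prop :=
  [/\ measurable_fun setT f, (forall x, 0 <= f x) &
    forall A : set (measurableTypeR R), measurable A ->
      distribution P X A = (\int[lebesgue_measure]_(x in A) (f x)%:E)%E].

(* [ln 0 = 0], so that [0 * log2 0 = 0] in the integrand. *)
Definition differential_entropy f : R :=
  - \int[lebesgue_measure]_(x in setT) (f x * log2 (f x)).

Definition joint_density f n (x : n.-tuple (measurableTypeR R)) : R :=
  \prod_(i < n) f (tnth x i).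

(* The positivity condition is implicit on paper, where [log 0 = -oo]; it has
   to be stated here because [ln 0 = 0]. *)
Definition typical_set f n B : set (n.-tuple (measurableTypeR R)) :=
  [set x | 0 < joint_density f x /\
    `| - (n%:R)^-1 * log2 (joint_density f x) - differential_entropy f | <= B].

End information_theory.

Arguments joint_density {R} f {n} x.
Arguments typical_set {R} f n B.

(* Main.v *)
Require Import Defs.
From HB Require Import structures.
From mathcomp Require Import all_boot all_order all_algebra.
From mathcomp Require Import all_classical all_reals all_analysis.
From mathcomp Require Import measurable_realfun ring lra.

Import Order.TTheory GRing.Theory Num.Theory.
Import numFieldNormedType.Exports.

Local Open Scope classical_set_scope.
Local Open Scope ring_scope.

(** The joint density integrates to 1 over R^n and is at least 2^(-n(h + B)) on
    the typical set, so by Markov's inequality that set has volume at most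
    2^(n(h + B)). It remains to bound the differential entropy h of f by
    log2 (sqrt (2 pi e) sigma): f agrees almost everywhere with the Gaussian
    density p, and the entropy of p only requires E[X^2] <= sigma^2. *)

(** * The joint density as a probability density on R^n *)

Lemma measurable_joint_density (R : realType) (f : R -> R) (n : nat) :
  measurable_fun setT f -> measurable_fun setT (@joint_density R f n).
Proof.
move=> mf; apply: measurable_prod => i _.
exact: (measurableT_comp mf (measurable_tnth i)).
Qed.

Lemma joint_density_ge0 (R : realType) (f : R -> R) (n : nat)
    (x : n.-tuple (measurableTypeR R)) :
  (forall x, 0 <= f x) -> 0 <= joint_density f x.
Proof. by move=> f0; apply: prodr_ge0. Qed.

(** By induction on [n]: Tonelli splits off the first coordinate, whose factor integrates to [c]. *)
Lemma integral_joint_density (R : realType) (f : R -> R) (c : R) (n : nat) :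
  measurable_fun setT f -> (forall x, 0 <= f x) ->
  (\int[lebesgue_measure]_x (f x)%:E = c%:E)%E ->
  (\int[lebesgue_measure_tuple n]_x (joint_density f x)%:E = (c ^+ n)%:E)%E.
Proof.
move=> mf f0 fc.
have c0 : 0 <= c.
  by rewrite -lee_fin -fc; apply: integral_ge0 => x _; rewrite lee_fin.
elim: n => [|n IH] /=.
  (* On R^0 the measure is a unit mass at the empty tuple, where the empty product is 1. *)
  rewrite integral_dirac//; last first.
    by apply/measurable_EFinP; exact: measurable_joint_density.
  by rewrite /joint_density big_ord0 diracT mul1e expr0.
rewrite (@ge0_integral_pushforward _ _ _ _ R _ (@measurable_tuple_consp R n)
  (lebesgue_measure \x lebesgue_measure_tuple n)%E setT
  (EFin \o joint_density f))//; last 2 first.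
- by apply/measurable_EFinP; exact: measurable_joint_density.
- by move=> x _; rewrite lee_fin joint_density_ge0.
rewrite preimage_setT fubini_tonelli1/=; last 2 first.
- apply/measurable_EFinP.
  apply: (@measurableT_comp _ _ _ _ _ _ (joint_density f) _ (@tuple_consp R n)).
  + exact: measurable_joint_density.
  + exact: measurable_tuple_consp.
- by move=> x; rewrite lee_fin joint_density_ge0.
transitivity (\int[lebesgue_measure]_x ((f x)%:E * (c ^+ n)%:E))%E.
  (* For a fixed first coordinate [x], the factor [f x] leaves the inner integral, which the
     induction hypothesis evaluates. *)
  apply: eq_integral => x _; rewrite /fubini_F -IH -ge0_integralZl//; last 3 first.
  - by apply/measurable_EFinP; exact: measurable_joint_density.
  - by move=> y _; rewrite lee_fin joint_density_ge0.
  - by rewrite lee_fin.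
  apply: eq_integral => y _; rewrite -EFinM; congr EFin.
  rewrite /joint_density big_ord_recl; congr (_ * _).
  by apply: eq_bigr => i _; rewrite tnthS.
rewrite ge0_integralZr//; last 3 first.
- exact/measurable_EFinP.
- by move=> x _; rewrite lee_fin.
- by rewrite lee_fin exprn_ge0.
by rewrite fc -EFinM exprS.
Qed.

(** * Volume of the typical set in terms of the entropy *)

Lemma measurable_typical_set (R : realType) (f : R -> R) (n : nat) (B : R) :
  measurable_fun setT f -> measurable (typical_set f n B).
Proof.
move=> mf; have mJ := @measurable_joint_density R f n mf.
rewrite -[typical_set _ _ _]setTI /typical_set -[X in measurable (_ `&` X)]/(
  [set x | 0 < joint_density f x] `&`
  [set x | `| - (n%:R)^-1 * log2 (joint_density f x) - differential_entropy f | <= B]).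
rewrite setIA; apply: measurableI.
  rewrite (_ : [set x | _] = joint_density f @^-1` `]0, +oo[).
    exact: mJ.
  by apply/seteqP; split=> x /=; rewrite in_itv/= andbT.
pose g (x : n.-tuple (measurableTypeR R)) :=
  `| - (n%:R)^-1 * log2 (joint_density f x) - differential_entropy f |.
rewrite (_ : [set x | _] = setT `&` g @^-1` `]-oo, B]); last first.
  by rewrite setTI; apply/seteqP; split=> x /=; rewrite in_itv.
suff mg : measurable_fun setT g by exact: mg.
apply: measurableT_comp => //; apply: measurable_funB => //.
apply: measurable_funM => //; apply: measurable_funM => //.
exact: measurableT_comp.
Qed.

(** The upper half of the two-sided bound reads - log2 J <= n (h + B); as J is positive, it can be
    exponentiated. *)
Lemma joint_density_typical_set_ge (R : realType) (f : R -> R) (n : nat) (B : R)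
    (x : n.-tuple (measurableTypeR R)) : (0 < n)%N ->
  typical_set f n B x ->
  2 `^ (- (n%:R * (differential_entropy f + B))) <= joint_density f x.
Proof.
move=> n0 [J0]; rewrite ler_norml => /andP[_].
have n0' : 0 < n%:R :> R by rewrite ltr0n.
have l2 : 0 < ln 2 :> R by rewrite ln_gt0// ltr1n.
move=> h; rewrite -ler_ln ?posrE ?powR_gt0// ln_powR.
rewrite -ler_pdivlMr// lerNl.
have := h; rewrite lerBlDl mulNr -(ler_pM2l n0') mulrN mulrA mulfV ?gt_eqF//.
by rewrite mul1r addrC.
Qed.

Lemma typical_set_volume_le (R : realType) (f : R -> R) (n : nat) (B : R) :
  (0 < n)%N -> measurable_fun setT f -> (forall x, 0 <= f x) ->
  (\int[lebesgue_measure]_x (f x)%:E = 1)%E ->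
  (lebesgue_measure_tuple n (typical_set f n B) <=
    (2 `^ (n%:R * (differential_entropy f + B)))%:E)%E.
Proof.
move=> n0 mf f0 f1.
set r := n%:R * _.
have a0 : 0 < 2 `^ (- r) :> R by rewrite powR_gt0.
have mJ : measurable_fun setT (EFin \o @joint_density R f n).
  by apply/measurable_EFinP; exact: measurable_joint_density.
(* Markov's inequality at level 2^(-r): 2^(-r) times the measure of the superlevel set is at most
   the integral of J, which is 1. *)
have := le_integral_abse (lebesgue_measure_tuple n) measurableT mJ a0.
under [leRHS]eq_integral.
  move=> x _; rewrite /= ger0_norm ?joint_density_ge0//; over.
rewrite (integral_joint_density _ _ _ _ mf f0 f1) expr1n => markov.
rewrite -[leRHS]mul1e -(opprK r) powRN lee_pdivlMr// muleC.
apply: le_trans markov; rewrite lee_pmul2l ?lte_fin//.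
apply: le_measure; rewrite ?inE.
- exact: measurable_typical_set.
- by apply: emeasurable_fun_c_infty => //; exact: measurableT_comp.
- move=> x /(joint_density_typical_set_ge _ _ _ _ _ n0) /= h; split=> //=.
  by rewrite lee_fin ger0_norm// joint_density_ge0.
Qed.

(** * Second moment of the centred Gaussian *)

Lemma normal_pdf0E (R : realType) (s : R) : s != 0 ->
  normal_pdf 0 s = fun x => normal_peak s * expR (- (s ^+ 2 *+ 2)^-1 * x ^+ 2).
Proof.
move=> s0; apply/funext => x; rewrite normal_pdfE// /normal_fun subr0.
by rewrite mulNr mulNr [_ / _]mulrC.
Qed.

(** The centred Gaussian density p satisfies p' = - (x / s^2) p, so the product rule applied to x p
    produces both terms. *)
Lemma is_derive_mulx_normal_pdf (R : realType) (s x : R) : 0 < s ->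
  is_derive x 1 (fun t : R => - s ^+ 2 * (t * normal_pdf 0 s t))
    (x ^+ 2 * normal_pdf 0 s x - s ^+ 2 * normal_pdf 0 s x).
Proof.
move=> s0; rewrite normal_pdf0E ?gt_eqF//.
set k := (s ^+ 2 *+ 2)^-1.
have dE : is_derive x 1 (fun t : R => expR (- k * t ^+ 2))
    (- k * (x *+ 2) * expR (- k * x ^+ 2)).
  have dq : is_derive x 1 (fun t : R => - k * t ^+ 2) (- k * (x *+ 2)).
    by apply: is_derive_eq; rewrite /GRing.scale/= !mulr1.
  have := @is_derive1_comp _ _ _ _ _ _ (is_derive_expR _) dq.
  by rewrite [X in is_derive _ _ _ X]mulrC.
apply: is_derive_eq; rewrite /GRing.scale/=.
by rewrite /k; field; rewrite gt_eqF.
Qed.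

(* Integrate (- s^2 x p)' = x^2 p - s^2 p over [-N, N]: the boundary terms are
   nonpositive, and N tends to infinity. *)
Lemma second_moment_normal_pdf_le (R : realType) (s : R) : 0 < s ->
  (\int[lebesgue_measure]_x (x ^+ 2 * normal_pdf 0 s x)%:E <= (s ^+ 2)%:E)%E.
Proof.
move=> s0; pose p := normal_pdf 0 s; pose m (x : R) := x ^+ 2 * p x.
pose F (t : R) : R := - s ^+ 2 * (t * p t).
pose q (x : R) := m x - s ^+ 2 * p x.
(* Using [n.+1] keeps the endpoints distinct even for [n = 0], as the fundamental theorem of
   calculus requires. *)
pose I (n : nat) : set R := `[(- n.+1%:R), n.+1%:R]%classic.
have mI n : measurable (I n : set (measurableTypeR R)) by exact: measurable_itv.
have p0 x : 0 <= p x by exact: normal_pdf_ge0.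
have dF (x : R) : is_derive x 1 F (q x) by exact: is_derive_mulx_normal_pdf.
have cp : continuous p by apply: continuous_normal_pdf; rewrite gt_eqF.
have cm : continuous m.
  by move=> x; apply: cvgM; [exact: exprn_continuous|exact: cp].
have cs : continuous (fun x => s ^+ 2 * p x).
  by move=> x; apply: cvgM; [exact: cvg_cst|exact: cp].
have cq : continuous q by move=> x; apply: cvgB; [exact: cm|exact: cs].
have cF : continuous F.
  by move=> x; apply: differentiable_continuous; exact/derivable1_diffP.
have int g n : continuous g -> lebesgue_measure.-integrable (I n) (EFin \o g).
  move=> cg; apply: continuous_compact_integrable; first exact: segment_compact.
  exact: continuous_subspaceT.
have mp : measurable_fun setT (EFin \o p).
  by apply/measurable_EFinP; exact: measurable_normal_pdf.
have mm : measurable_fun setT (EFin \o m).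
  by apply/measurable_EFinP; exact: continuous_measurable_fun.
have bound n : (\int[lebesgue_measure]_(x in I n) (m x)%:E <= (s ^+ 2)%:E)%E.
  have -> : (\int[lebesgue_measure]_(x in I n) (m x)%:E =
      \int[lebesgue_measure]_(x in I n) ((q x)%:E + (s ^+ 2 * p x)%:E))%E.
    by apply: eq_integral => x _; rewrite -EFinD subrK.
  rewrite integralD//; last 2 first.
  - exact: (int _ _ cq).
  - exact: (int _ _ cs).
  (* The integral of [q] is F(N) - F(-N) <= 0, and that of s^2 p is at most s^2 because p has total
     mass 1. *)
  rewrite -[leRHS]add0e; apply: leeD.
    rewrite (@continuous_FTC2 _ q F)//.
    - rewrite -EFinB lee_fin subr_le0.
      rewrite /F !mulNr lerN2 mulrN.
      by apply: (@le_trans _ _ 0); rewrite ?mulNr ?mulrN ?oppr_le0 !mulr_ge0 ?(ltW s0).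
    - by rewrite gtrN.
    - exact: continuous_subspaceT.
    - split=> [x _||].
      + by case: (dF x).
      + by apply: cvg_at_right_filter; exact: cF.
      + by apply: cvg_at_left_filter; exact: cF.
    - by move=> x _; rewrite derive1E; case: (dF x).
  under eq_integral do rewrite EFinM.
  rewrite ge0_integralZl//; last 3 first.
  - exact: measurable_funTS.
  - by move=> x _; rewrite lee_fin.
  - by rewrite lee_fin sqr_ge0.
  rewrite -[leRHS]mule1; apply: lee_wpmul2l; first by rewrite lee_fin sqr_ge0.
  rewrite -(integral_normal_pdf 0 s); apply: ge0_subset_integral => //.
  by move=> x _; rewrite lee_fin.
have IT : \bigcup_n I n = setT.
  apply/seteqP; split=> // x _; exists (Num.truncn `|x|) => //.
  by rewrite /I/= in_itv/= -ler_norml ltW// truncnS_gt.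
have : (\int[lebesgue_measure]_(x in I n) (m x)%:E @[n --> \oo] -->
    \int[lebesgue_measure]_(x in \bigcup_n I n) (m x)%:E)%E.
  apply: ge0_nondecreasing_set_cvg_integral => //.
  - move=> a b ab; apply/subsetPset => x; rewrite /I/= !in_itv/= -!ler_norml.
    by move=> /le_trans; apply; rewrite ler_nat.
  - by move=> i; exact: measurable_funTS.
  - by move=> i x _; rewrite lee_fin mulr_ge0 ?sqr_ge0.
rewrite IT => cv.
rewrite -(cvg_lim _ cv)//; apply: lime_le.
  by apply/cvg_ex; eexists; exact: cv.
by apply: nearW => n; exact: bound.
Qed.

(** * Entropy of the Gaussian *)

Lemma powR2_log2 (R : realType) (a : R) : 0 < a -> 2 `^ (log2 a) = a.
Proof.
move=> a0; rewrite /powR pnatr_eq0/= /log2 divfK ?lnK//.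
by rewrite gt_eqF// ln_gt0// ltr1n.
Qed.

(** A density of X is determined only up to a null set; this allows an arbitrary one to be replaced
    by [normal_pdf]. *)
Lemma differential_entropy_ae_eq (R : realType) (f g : R -> R) :
  measurable_fun setT f -> measurable_fun setT g ->
  ae_eq lebesgue_measure setT (EFin \o f) (EFin \o g) ->
  differential_entropy f = differential_entropy g.
Proof.
move=> mf mg fg; rewrite /differential_entropy /Rintegral; congr (- fine _).
have ml (h : R -> R) : measurable_fun setT h ->
    measurable_fun setT (fun x => (h x * log2 (h x))%:E).
  move=> mh; apply/measurable_EFinP; apply: measurable_funM => //.
  by apply: measurable_funM => //; exact: measurableT_comp.
apply: ae_eq_integral => //; [exact: ml|exact: ml|].
by apply: filterS fg => x /= + _ => /(_ I) [->].
Qed.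

(** The inverse peak is sqrt (2 pi) s, and e leaves the root as e^(1/2). In this form the logarithm
    of the constant is 1/2 - ln c, where c is the peak. *)
Lemma normal_peakV_expR (R : realType) (s : R) : 0 < s ->
  Num.sqrt (2 * pi * expR 1) * s = (normal_peak s)^-1 * expR 2^-1.
Proof.
move=> s0; have -> : expR 1 = expR 2^-1 ^+ 2 :> R.
  by rewrite expr2 -expRD; congr expR; lra.
rewrite /normal_peak invrK sqrtrM; last by rewrite mulr_ge0 ?pi_ge0.
rewrite sqrtr_sqr ger0_norm ?expR_ge0//.
have -> : s ^+ 2 * pi *+ 2 = s ^+ 2 * (2 * pi) by ring.
by rewrite [in RHS]sqrtrM ?sqr_ge0// sqrtr_sqr gtr0_norm//; ring.
Qed.

(** Since ln p = ln c - k x^2 with k = 1 / (2 s^2), the entropy is (k E[X^2] - ln c) / ln 2, and k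
    E[X^2] <= k s^2 = 1/2. *)
Lemma differential_entropy_normal_pdf_le (R : realType) (s : R) : 0 < s ->
  differential_entropy (normal_pdf 0 s) <=
    log2 (Num.sqrt (2 * pi * expR 1) * s).
Proof.
move=> s0; have sN0 : s != 0 by rewrite gt_eqF.
have l2 : 0 < ln 2 :> R by rewrite ln_gt0// ltr1n.
set p := normal_pdf 0 s; set c := normal_peak s; pose k := (s ^+ 2 *+ 2)^-1.
have c0 : 0 < c by exact: normal_peak_gt0.
have cV0 : 0 < c^-1 by rewrite invr_gt0.
have k0 : 0 <= k by rewrite invr_ge0 mulrn_wge0// sqr_ge0.
pose m (x : R) := x ^+ 2 * p x.
have m0 x : 0 <= m x by rewrite mulr_ge0 ?sqr_ge0 ?normal_pdf_ge0.
have mle := second_moment_normal_pdf_le _ _ s0; rewrite -/p in mle.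
have ip : lebesgue_measure.-integrable setT (EFin \o p).
  exact: integrable_normal_pdf.
(* The moment bound also gives integrability, without which the real-valued integral below could not
   be split. *)
have im : lebesgue_measure.-integrable setT (EFin \o m).
  apply/integrableP; split.
    apply/measurable_EFinP; apply: measurable_funM; first exact: measurable_funX.
    exact: measurable_normal_pdf.
  under eq_integral do rewrite /= ger0_norm ?m0//.
  by rewrite (le_lt_trans mle)// ltry.
have Mle : \int[lebesgue_measure]_(x in setT) m x <= s ^+ 2.
  rewrite -lee_fin /Rintegral fineK//; exact: integrable_fin_num.
have p1 : \int[lebesgue_measure]_(x in setT) p x = 1.
  by rewrite /Rintegral integral_normal_pdf.
have -> : differential_entropy p = (ln 2)^-1 *
    (k * \int[lebesgue_measure]_(x in setT) m x - ln c).
  rewrite /differential_entropy.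
  have -> : (fun x => p x * log2 (p x)) =
      (fun x => (ln c / ln 2) * p x + (- k / ln 2) * m x).
    apply/funext => x; rewrite /m /p normal_pdf0E// /log2.
    rewrite lnM ?posrE ?expR_gt0// expRK -/k.
    by rewrite -/c; ring.
  rewrite RintegralD//; last 2 first.
  - exact: (integrableZl measurableT (ln c / ln 2) ip).
  - exact: (integrableZl measurableT (- k / ln 2) im).
  by rewrite !RintegralZl// p1; ring.
rewrite normal_peakV_expR// -/c /log2 lnM ?posrE ?expR_gt0//.
rewrite expRK [ln c^-1]lnV ?posrE// [leRHS]mulrC ler_pM2l ?invr_gt0// addrC lerD2l.
have -> : 2^-1 = k * s ^+ 2 by rewrite /k; field.
exact: ler_wpM2l.
Qed.

(** * From the entropy bound to the volume bound *)

Theorem proposition3p15 (R : realType) (d : measure_display)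
    (T : measurableType d) (P : probability T R)
    (X : {RV P >-> measurableTypeR R}) (f : R -> R)
    (sigma eta eps : R) (n : nat)
    (hsigma : 0 < sigma) (heta : 0 <= eta) (heps : 0 < eps) (hn : (1 <= n)%N)
    (hX : forall A : set (measurableTypeR R), measurable A ->
      distribution P X A = normal_prob 0 sigma A)
    (hf : is_density X f) :
  let B2 := (eta ^+ 2 + 2 * eta * Num.sqrt (n%:R * sigma ^+ 2 * (1 + 2 * eps)))
            / (2 * n%:R * sigma ^+ 2) + eps in
  (lebesgue_measure_tuple n (typical_set f n B2) <=
    ((2 `^ B2 * Num.sqrt (2 * pi * expR 1) * sigma) ^+ n)%:E)%E.
Proof.
lazy zeta; set B2 := _ / _ + eps; case: hf => mf f0 Xf.
have fp A : measurable A -> (\int[lebesgue_measure]_(x in A) (f x)%:E =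
    \int[lebesgue_measure]_(x in A) (normal_pdf 0 sigma x)%:E)%E.
  by move=> mA; rewrite -Xf// hX.
have f1 : (\int[lebesgue_measure]_x (f x)%:E = 1)%E.
  by rewrite fp// integral_normal_pdf.
have mp := measurable_normal_pdf 0 sigma.
have hle : differential_entropy f <=
    log2 (Num.sqrt (2 * pi * expR 1) * sigma).
  (* [f] and the Gaussian density have equal integrals over every measurable set, hence agree almost
     everywhere. *)
  rewrite -(differential_entropy_ae_eq _ _ _ mp mf).
    exact: differential_entropy_normal_pdf_le.
  apply: integral_ae_eq => //; [exact: integrable_normal_pdf| |].
    exact/measurable_EFinP.
  by move=> A _ mA; rewrite fp.
apply: (le_trans (typical_set_volume_le _ _ _ _ hn mf f0 f1)).
(* Both sides are now n-th powers of nonnegative reals, so comparing the bases suffices. *)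
rewrite lee_fin mulrC powRrM powR_mulrn ?powR_ge0//.
apply: lerXn2r; rewrite ?nnegrE ?powR_ge0//.
  by rewrite !mulr_ge0 ?powR_ge0 ?sqrtr_ge0// ltW.
have a0 : 0 < Num.sqrt (2 * pi * expR 1) * sigma :> R.
  by rewrite mulr_gt0// sqrtr_gt0 !mulr_gt0 ?pi_gt0 ?expR_gt0.
(* With sqrt (2 pi e) sigma written as a power of 2, only the exponents h + B2 and B2 + log2 (sqrt
   (2 pi e) sigma) remain to be compared. *)
rewrite -mulrA -[X in _ <= _ * X](powR2_log2 _ _ a0) -powRD ?pnatr_eq0 ?implybT//.
by apply: ler_powR; rewrite ?ler1n// addrC lerD2l.
Qed.
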